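(* Let $S:\mathbb{R}^n\rightrightarrows\mathbb{R}^m$ be a set-valued mapping, $\bar{x}\in X\subset\mathbb{R}^n$, $\bar{u}\in S(\bar{x})$ and $\tilde{\kappa}>\kappa>0$. Suppose that $\operatorname{gph}S$ is locally closed at $(\bar{x},\bar{u})$ and that $X$ is closed. If the condition $$\max_{w\in\operatorname{cl}\operatorname{pos}(X-x)\cap\mathbb{S}}\langle x^*,w\rangle\le\kappa\|u^*\|\qquad\text{for all } u^*\in\mathbb{R}^m\text{ and all } x^*\in D^*S|_X(x\mid u)(u^* )$$ holds for all $(x,u)$ close enough to $(\bar{x},\bar{u})$ in $\operatorname{gph}S|_X$, then $S$ has the Lipschitz-like property relative to $X$ at $\bar{x}$ for $\bar{u}$ with constant $\tilde{\kappa}$.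
   Context: $\|\cdot\|$ is the Euclidean norm, $\mathbb{B}$ the closed unit ball, $\mathbb{S}$ the unit sphere, $\operatorname{cl}$ the closure, and $\operatorname{pos}A=\{0\}\cup\{\lambda x\mid x\in A,\ \lambda>0\}$. A set $A$ is locally closed at $x\in A$ if $A\cap U$ is closed for some closed neighborhood $U$ of $x$. $\operatorname{gph}S=\{(x,u)\mid u\in S(x)\}$. The restricted mapping $S|_X$ is $S|_X(x)=S(x)$ if $x\in X$ and $\emptyset$ otherwise, so $\operatorname{gph}S|_X=\operatorname{gph}S\cap(X\times\mathbb{R}^m)$. Lipschitz-like property relative to $X$ at $\bar x$ for $\bar u$ with constant $\kappa\ge0$: $\operatorname{gph}S$ is locally closed at $(\bar{x},\bar{u})$ and there are neighborhoods $V$ of $\bar{x}$ and $W$ of $\bar{u}$ such that $S(x')\cap W\subset S(x)+\kappa\|x'-x\|\mathbb{B}$ for all $x,x'\in X\cap V$. For $x\in A$, the tangent (contingent) cone $T_A(x)$ consists of all $w$ for which there exist $t_k\downarrow0$, $w_k\to w$ with $x+t_kw_k\in A$ for all $k$; $\widehat{N}_A(x)=\{v\mid\langle v,w\rangle\le0\ \forall w\in T_A(x)\}$; the (limiting) normal cone $N_A(x)$ consists of all $v$ for which there exist $x_k\to x$, $v_k\to v$ with $x_k\in A$ and $v_k\in\widehat{N}_A(x_k)$. For $(x,u)\in\operatorname{gph}S|_X$, the coderivative $D^*S|_X(x\mid u):\mathbb{R}^m\rightrightarrows\mathbb{R}^n$ is defined by $x^*\in D^*S|_X(x\mid u)(u^*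 )\iff(x^*,-u^* )\in N_{\operatorname{gph}S|_X}(x,u)$. The maximum over an empty set is read as $-\infty$ (the condition is then vacuous). *)

(* Defs.v *)
From mathcomp Require Import all_boot all_order all_algebra.
From mathcomp Require Import all_classical all_reals all_analysis.
Import Order.TTheory GRing.Theory Num.Theory.
Import numFieldNormedType.Exports.

Set Implicit Arguments.
Unset Strict Implicit.
Unset Printing Implicit Defensive.

Local Open Scope classical_set_scope.
Local Open Scope ring_scope.

(* R^n is 'rV[R]_n.  Its library topology is the usual one, but the library
   norm `|_| on matrices is the maximum norm, so the Euclidean norm is
   introduced separately. *)

Definition dotv (R : realType) (n : nat) (u v : 'rV[R]_n) : R :=
  \sum_(i < n) u 0 i * v 0 i.

Definition enorm (R : realType) (n : nat) (u : 'rV[R]_n) : R :=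
  Num.sqrt (dotv u u).

Definition eball (R : realType) (n : nat) : set 'rV[R]_n :=
  [set v | enorm v <= 1].

Definition esphere (R : realType) (n : nat) : set 'rV[R]_n :=
  [set v | enorm v = 1].

Arguments eball {R n}.
Arguments esphere {R n}.

Definition pos_hull (R : realType) (n : nat) (A : set 'rV[R]_n) :
    set 'rV[R]_n :=
  [set 0] `|` [set y | exists l x, [/\ 0 < l, A x & y = l *: x]].

Definition locally_closed (T : topologicalType) (A : set T) (x : T) : Prop :=
  exists U : set T, [/\ nbhs x U, closed U & closed (A `&` U)].

(* A set-valued mapping is a function to sets, and R^n x R^m is identified
   with R^(n+m), the pair (x, u) being the row vector row_mx x u. *)

Definition gph (R : realType) (n m : nat) (S : 'rV[R]_n -> set 'rV[R]_m) :
    set 'rV[R]_(n + m) :=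
  [set z | S (lsubmx z) (rsubmx z)].

Definition restr (R : realType) (n m : nat) (S : 'rV[R]_n -> set 'rV[R]_m)
    (X : set 'rV[R]_n) : 'rV[R]_n -> set 'rV[R]_m :=
  fun x => [set u | X x /\ S x u].

Definition lipschitz_like (R : realType) (n m : nat)
    (S : 'rV[R]_n -> set 'rV[R]_m) (X : set 'rV[R]_n)
    (xbar : 'rV[R]_n) (ubar : 'rV[R]_m) (kappa : R) : Prop :=
  [/\ 0 <= kappa,
      locally_closed (gph S) (row_mx xbar ubar) &
      exists V W, [/\ nbhs xbar V, nbhs ubar W &
        forall x x', (X `&` V) x -> (X `&` V) x' ->
          S x' `&` W `<=`
            [set u + (kappa * enorm (x' - x)) *: b | u in S x & b in eball]]].

(* The contingent cone.  Here t_k decreasing to 0 means, as is customary,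
   0 < t_k and t_k --> 0; monotonicity could be obtained by passing to a
   subsequence. *)
Definition tangent_cone (R : realType) (n : nat) (A : set 'rV[R]_n)
    (x : 'rV[R]_n) : set 'rV[R]_n :=
  [set w | exists (t : nat -> R) (y : nat -> 'rV[R]_n),
    [/\ forall k, 0 < t k,
        t @ \oo --> (0 : R),
        y @ \oo --> w &
        forall k, A (x + t k *: y k)]].

Definition regular_normal_cone (R : realType) (n : nat) (A : set 'rV[R]_n)
    (x : 'rV[R]_n) : set 'rV[R]_n :=
  [set v | forall w, tangent_cone A x w -> dotv v w <= 0].

Definition normal_cone (R : realType) (n : nat) (A : set 'rV[R]_n)
    (x : 'rV[R]_n) : set 'rV[R]_n :=
  [set v | exists y q : nat -> 'rV[R]_n,
    [/\ y @ \oo --> x,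
        q @ \oo --> v,
        forall k, A (y k) &
        forall k, regular_normal_cone A (y k) (q k)]].

Definition coderivative (R : realType) (n m : nat)
    (S : 'rV[R]_n -> set 'rV[R]_m) (x : 'rV[R]_n) (u : 'rV[R]_m) :
    'rV[R]_m -> set 'rV[R]_n :=
  fun us => [set xs | normal_cone (gph S) (row_mx x u) (row_mx xs (- us))].

(* The maximum of <xs, .> over A as an extended real, equal to -oo when A is
   empty; on a nonempty compact A the supremum is attained. *)
Definition max_dot (R : realType) (n : nat) (xs : 'rV[R]_n)
    (A : set 'rV[R]_n) : \bar R :=
  ereal_sup [set (dotv xs w)%:E | w in A].

(* Main.v *)
Require Import Defs.
From mathcomp Require Import all_boot all_order all_algebra.
From mathcomp Require Import all_classical all_reals all_analysis.
From mathcomp Require Import ring lra.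
Import Order.TTheory GRing.Theory Num.Theory.
Import numFieldNormedType.Exports.
Local Open Scope classical_set_scope.
Local Open Scope ring_scope.

(** The statement follows from one minimization over the graph [G] of the
restricted mapping.  Take [x, x'] in [X] near [xbar] and [u'] in [S x'] near
[ubar], with [x != x'], choose [k] strictly between [kappa] and [kappa'], and
put a small [e > 0].  Among the points [(z, u)] of [G] near [(xbar, ubar)]
minimize the penalty
  [k * |z - x| + sqrt (|u - u'|^2 + e^2)].
Comparing a minimizer [(z, u)] with the competitor [(x', u')], both [k * |z - x|]
and [|u - u'|] are at most [k * |x' - x| + e], which is [kappa' * |x' - x|] for
the choice [e = (kappa' - k) * |x' - x|].  So if [z = x], the point [u] of
[S x] is as close to [u'] as the Lipschitz-like property asks
([minimizer_over_slice]).

It remains to exclude [z != x].  The penalty is then smooth at [(z, u)], so its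
negative gradient is a regular normal of [G] ([penalty_min_normal]).  This
normal is [(xs, - us)] with [xs = k *: w], where [w] is the unit vector pointing
from [z] to [x], and [|us| <= 1].  Since [x] belongs to [X], [w] is one of the
directions that the hypothesis on the coderivative allows, and the hypothesis
yields [k = <xs, w> <= kappa * |us| <= kappa], which is absurd
([descent_dir_not_normal]).

Smoothing the distance in [u] by [e] is what makes this work with regular
normals only: the unsmoothed distance fails to be differentiable at [u = u'],
and the limiting normal cone and its sum rule would be needed there.  The room
between [kappa] and [kappa'] pays for [e].  No derivative is computed either:
the gradient inequality is obtained from a quadratic upper bound of the
smoothed norm ([smooth_norm_upper]), and a vector [v] such that
[<v, q - p> <= c * |q - p|^2] on a set near [p] is a regular normal at [p]
([proximal_regular_normal]). *)

(** * Euclidean norm and its smoothing *)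

Section InnerProduct.
Set Implicit Arguments.
Unset Strict Implicit.
Variables (R : realType) (n : nat).
Implicit Types (u v w : 'rV[R]_n) (a e : R).

Lemma dotvC u v : dotv u v = dotv v u.
Proof. by apply: eq_bigr => i _; rewrite mulrC. Qed.

Lemma dotvDr u v w : dotv u (v + w) = dotv u v + dotv u w.
Proof. by rewrite -big_split; apply: eq_bigr => i _; rewrite !mxE mulrDr. Qed.

Lemma dotvZr a u v : dotv u (a *: v) = a * dotv u v.
Proof. by rewrite mulr_sumr; apply: eq_bigr => i _; rewrite !mxE mulrCA. Qed.

Lemma dotvDl u v w : dotv (u + v) w = dotv u w + dotv v w.
Proof. by rewrite !(dotvC _ w) dotvDr. Qed.

Lemma dotvZl a u v : dotv (a *: u) v = a * dotv u v.
Proof. by rewrite !(dotvC _ v) dotvZr. Qed.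

Lemma dotv_ge0 v : 0 <= dotv v v.
Proof. by apply: sumr_ge0 => i _; rewrite -expr2 sqr_ge0. Qed.

Lemma enorm_ge0 v : 0 <= enorm v.
Proof. exact: sqrtr_ge0. Qed.

Lemma sqr_enorm v : enorm v ^+ 2 = dotv v v.
Proof. by rewrite sqr_sqrtr ?dotv_ge0. Qed.

Lemma enormZ a v : 0 <= a -> enorm (a *: v) = a * enorm v.
Proof.
move=> a0; rewrite /enorm dotvZl dotvZr mulrA -expr2 sqrtrM ?sqr_ge0//.
by rewrite sqrtr_sqr ger0_norm.
Qed.

Lemma enormN v : enorm (- v) = enorm v.
Proof. by rewrite /enorm -scaleN1r dotvZl dotvZr !mulN1r opprK. Qed.

Lemma normrV_le v a : 0 <= a -> (forall i, `|v 0 i| <= a) -> `|v| <= a.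
Proof.
move=> a0 va; rewrite [leLHS]/Num.Def.normr /= mx_normrE.
by apply/bigmax_leP; split => // -[i j] _ /=; rewrite ord1.
Qed.

Lemma ler_coord_norm v i : `|v 0 i| <= `|v|.
Proof.
rewrite [leRHS]/Num.Def.normr /= mx_normrE.
by apply/bigmax_geP; right; exists (0, i).
Qed.

Lemma norm_le_enorm v : `|v| <= enorm v.
Proof.
apply: normrV_le => [|i]; first exact: enorm_ge0.
rewrite -sqrtr_sqr ler_wsqrtr// /dotv (bigD1 i)//= -expr2 lerDl.
by apply: sumr_ge0 => j _; rewrite -expr2 sqr_ge0.
Qed.

Lemma enorm_le_norm v : enorm v <= Num.sqrt n%:R * `|v|.
Proof.
rewrite -[X in _ * X]ger0_norm// -sqrtr_sqr -sqrtrM// ler_wsqrtr//.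
rewrite mulr_natl -[X in _ *+ X](card_ord n) -sumr_const.
apply: ler_sum => i _; rewrite -expr2 -real_normK ?num_real//.
by rewrite lerXn2r ?nnegrE// ler_coord_norm.
Qed.

Lemma enorm_gt0 v : v != 0 -> 0 < enorm v.
Proof. by move=> v0; apply: lt_le_trans (norm_le_enorm v); rewrite normr_gt0. Qed.

Lemma cvg_dotv (T : Type) (F : set_system T) (FF : Filter F)
    (f g : T -> 'rV[R]_n) u v :
  f @ F --> u -> g @ F --> v -> (fun t => dotv (f t) (g t)) @ F --> dotv u v.
Proof.
move=> fu gv; apply: cvg_big => [|i _]; first exact: add_continuous.
apply: cvgM.
  by apply: (continuous_cvg FF (h := fun z : 'rV[R]_n => z 0 i) _ fu);
    exact: coord_continuous.
by apply: (continuous_cvg FF (h := fun z : 'rV[R]_n => z 0 i) _ gv);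
  exact: coord_continuous.
Qed.

(** Taking [e = 0] recovers the Euclidean norm, which lets one quadratic bound
serve both terms of the penalty below. *)
Definition smooth_norm e v : R := Num.sqrt (dotv v v + e ^+ 2).

Lemma smooth_norm0 v : smooth_norm 0 v = enorm v.
Proof. by rewrite /smooth_norm expr0n addr0. Qed.

Lemma smooth_norm_at0 e : 0 <= e -> smooth_norm e 0 = e.
Proof.
move=> e0; rewrite /smooth_norm (_ : dotv 0 0 = 0); last first.
  by apply: big1 => i _; rewrite mxE mul0r.
by rewrite add0r sqrtr_sqr ger0_norm.
Qed.

Lemma enorm0 : enorm (0 : 'rV[R]_n) = 0.
Proof. by rewrite -smooth_norm0 smooth_norm_at0. Qed.

Lemma enorm_le_smooth e v : enorm v <= smooth_norm e v.
Proof. by rewrite ler_wsqrtr// lerDl sqr_ge0. Qed.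

Lemma smooth_norm_ge e v : 0 <= e -> e <= smooth_norm e v.
Proof.
move=> e0; rewrite -[leLHS]ger0_norm// -sqrtr_sqr ler_wsqrtr// lerDr.
exact: dotv_ge0.
Qed.

Lemma cvg_smooth_norm (T : Type) (F : set_system T) (FF : Filter F) e
    (f : T -> 'rV[R]_n) v :
  f @ F --> v -> (fun t => smooth_norm e (f t)) @ F --> smooth_norm e v.
Proof.
move=> fv; apply: (continuous_cvg FF (h := Num.sqrt) (@sqrt_continuous R _)).
by apply: cvgD; [exact: cvg_dotv|exact: cvg_cst].
Qed.

(** The inequality [sqrt b <= (N + b / N) / 2] between geometric and arithmetic
means, at [b = |v + w|^2 + e^2] and [N = smooth_norm e v], gives the linear term
of the gradient and a quadratic remainder whose coefficient does not depend
on [w]. *)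
Lemma smooth_norm_upper e v w : 0 < smooth_norm e v ->
  smooth_norm e (v + w) <=
    smooth_norm e v + dotv ((smooth_norm e v)^-1 *: v) w + (smooth_norm e v)^-1 * dotv w w.
Proof.
set N := smooth_norm e v => N0; set M := smooth_norm e (v + w).
have NE : N ^+ 2 = dotv v v + e ^+ 2.
  by rewrite sqr_sqrtr// addr_ge0 ?dotv_ge0 ?sqr_ge0.
have ME : M ^+ 2 = N ^+ 2 + 2 * dotv v w + dotv w w.
  rewrite sqr_sqrtr ?addr_ge0 ?dotv_ge0 ?sqr_ge0// NE.
  by rewrite dotvDr !dotvDl (dotvC w v); ring.
have ww := dotv_ge0 w.
rewrite dotvZl -(ler_pM2l N0) !mulrDr !mulrA divff ?gt_eqF// !mul1r.
(* Twice the gap is now [(M - N)^2 + dotv w w]. *)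
by have := sqr_ge0 (M - N); nra.
Qed.

End InnerProduct.

(** * Regular normals at minimizers of the penalty *)

Section RegularNormals.
Set Implicit Arguments.
Unset Strict Implicit.
Variables (R : realType).

(** Along a tangent sequence [p + t k *: y k] the hypothesis divided by [t k] reads
[<v, y k> <= c * t k * |y k|^2], whose right-hand side tends to [0]. *)
Lemma proximal_regular_normal n (A : set 'rV[R]_n) (p v : 'rV[R]_n) (c : R) :
  (\forall q \near p, A q -> dotv v (q - p) <= c * dotv (q - p) (q - p)) ->
  regular_normal_cone A p v.
Proof.
move=> vp w [t [y [t0 tc yw Ay]]].
have tyc : (fun k => p + t k *: y k) @ \oo --> p.
  by rewrite -[X in _ --> X]addr0 -(scale0r w); apply: cvgD;
    [exact: cvg_cst|exact: cvgZ].
have : (fun k => dotv v (y k) - c * (t k * dotv (y k) (y k))) @ \oo -->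
       dotv v w - c * (0 * dotv w w).
  apply: cvgB; first by apply: cvg_dotv => //; exact: cvg_cst.
  by apply: cvgM; [exact: cvg_cst|apply: cvgM => //; exact: cvg_dotv].
rewrite mul0r mulr0 subr0 => /cvgr_to_le; apply.
apply: (@filterS _ \oo _ _ _ _ (tyc _ vp)) => k /(_ (Ay k)).
rewrite addrC addKr dotvZl !dotvZr mulrCA (ler_pM2l (t0 k)) => h.
by rewrite subr_le0.
Qed.

(** The two terms are treated differently on purpose: the unsmoothed one keeps a
slope of exactly [k] up to the slice over [x], the smoothed one has gradients
of norm at most [1] and no kink at [u]. *)
Definition penalty n m (k e : R) (x : 'rV[R]_n) (u : 'rV[R]_m)
    (q : 'rV[R]_(n + m)) : R :=
  k * enorm (lsubmx q - x) + smooth_norm e (rsubmx q - u).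

(** The negative gradient of [penalty] at a point off the slice over [x]. *)
Definition penalty_descent_dir n m (k e : R) (x : 'rV[R]_n) (u : 'rV[R]_m)
    (q : 'rV[R]_(n + m)) : 'rV[R]_(n + m) :=
  row_mx ((k / enorm (lsubmx q - x)) *: (x - lsubmx q))
         (- ((smooth_norm e (rsubmx q - u))^-1 *: (rsubmx q - u))).

Lemma dotv_row_mx n m (a : 'rV[R]_n) (b : 'rV[R]_m) q :
  dotv (row_mx a b) q = dotv a (lsubmx q) + dotv b (rsubmx q).
Proof.
rewrite /dotv big_split_ord /=; congr (_ + _); apply: eq_bigr => i _.
  by rewrite row_mxEl mxE.
by rewrite row_mxEr mxE.
Qed.

Lemma cvg_penalty n m k e x u (T : Type) (F : set_system T) (FF : Filter F)
    (f : T -> 'rV[R]_(n + m)) q :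
  f @ F --> q ->
  (fun t => penalty k e x u (f t)) @ F --> @penalty n m k e x u q.
Proof.
move=> fq; rewrite /penalty.
have lq := continuous_cvg FF (@continuous_lsubmx R 1 n m q) fq.
have rq := continuous_cvg FF (@continuous_rsubmx R 1 n m q) fq.
apply: cvgD; last first.
  by apply: cvg_smooth_norm; apply: cvgB; [exact: rq|exact: cvg_cst].
apply: cvgM; first exact: cvg_cst.
rewrite -smooth_norm0; under eq_fun do rewrite -smooth_norm0.
by apply: cvg_smooth_norm; apply: cvgB; [exact: lq|exact: cvg_cst].
Qed.

Lemma penalty_continuous n m k e x u : continuous (@penalty n m k e x u).
Proof.
by move=> q; exact: (@cvg_penalty _ _ k e x u _ (nbhs q) _ id q cvg_id).
Qed.

(** Minimality turns the quadratic upper bounds of the two norms into a quadratic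
bound for the descent direction, that is, into a proximal normal. *)
Lemma penalty_min_normal n m (k e : R) x u (A : set 'rV[R]_(n + m))
    (p : 'rV[R]_(n + m)) :
  0 <= k -> 0 < e -> lsubmx p != x ->
  (\forall q \near p, A q -> penalty k e x u p <= penalty k e x u q) ->
  regular_normal_cone A p (penalty_descent_dir k e x u p).
Proof.
move=> k0 e0 px pmin.
rewrite /penalty_descent_dir; set a := lsubmx p - x; set b := rsubmx p - u.
have a0 : 0 < enorm a by rewrite enorm_gt0// subr_eq0.
have b0 : 0 < smooth_norm e b by exact: lt_le_trans (smooth_norm_ge _ (ltW e0)).
pose c := k * (enorm a)^-1 + (smooth_norm e b)^-1.
apply: (@proximal_regular_normal _ _ _ _ c).
apply: filterS pmin => q pq Aq; have {pq} := pq Aq.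
set h := q - p.
have qE : q = p + h by rewrite addrC subrK.
have lE : lsubmx q - x = a + lsubmx h by rewrite qE linearD /= addrAC.
have rE : rsubmx q - u = b + rsubmx h by rewrite qE linearD /= addrAC.
rewrite /penalty -/a -/b lE rE dotv_row_mx => pq.
have := @smooth_norm_upper _ _ 0 a (lsubmx h); rewrite !smooth_norm0 => /(_ a0) ua.
have ub := @smooth_norm_upper _ _ e b (rsubmx h) b0.
have -> : dotv h h = dotv (lsubmx h) (lsubmx h) + dotv (rsubmx h) (rsubmx h).
  by rewrite -[X in dotv X _](hsubmxK h) dotv_row_mx.
have := ler_wpM2l k0 ua; move: {ua} ub pq.
rewrite -(opprB (lsubmx p)) -/a -scaleN1r -[- (_ *: b)]scaleN1r !dotvZl /c.
have := dotv_ge0 (lsubmx h); have := dotv_ge0 (rsubmx h).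
have : 0 <= (enorm a)^-1 by rewrite invr_ge0 ltW.
have : 0 <= (smooth_norm e b)^-1 by rewrite invr_ge0 ltW.
move: (enorm a)^-1 (smooth_norm e b)^-1 (dotv (lsubmx h) _) (dotv (rsubmx h) _).
move: (dotv a _) (dotv b _).
move=> ah bh ia ib A1 B1 ib0 ia0 B0 A0 ub pq ua.
have kia : 0 <= k * ia by rewrite mulr_ge0.
have := mulr_ge0 kia B0; have := mulr_ge0 ib0 A0; nra.
Qed.

End RegularNormals.

(** * From minimizers to points over the target argument *)

Section Descent.
Set Implicit Arguments.
Unset Strict Implicit.
Variables (R : realType) (n m : nat).

Lemma sub_row_mx_norm_lt (x : 'rV[R]_n) (u : 'rV[R]_m) q r :
  `|x - lsubmx q| < r -> `|u - rsubmx q| < r -> `|row_mx x u - q| < r.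
Proof.
move=> xr ur; rewrite -[q]hsubmxK opp_row_mx add_row_mx.
set a := x - _; set b := u - _.
apply: (@le_lt_trans _ _ (Num.max `|a| `|b|)); last by rewrite gt_max xr.
apply: normrV_le => [|i]; first by rewrite le_max normr_ge0.
rewrite le_max mxE; case: splitP => j _.
  by rewrite ler_coord_norm.
by rewrite ler_coord_norm orbT.
Qed.

Lemma norm_lsubmx_sub (x : 'rV[R]_n) (u : 'rV[R]_m) q :
  `|x - lsubmx q| <= `|row_mx x u - q|.
Proof.
apply: normrV_le => // i; apply: le_trans (ler_coord_norm _ (lshift m i)).
by rewrite !mxE (unsplitK (inl i)).
Qed.

Lemma norm_rsubmx_sub (x : 'rV[R]_n) (u : 'rV[R]_m) q :
  `|u - rsubmx q| <= `|row_mx x u - q|.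
Proof.
apply: normrV_le => // i; apply: le_trans (ler_coord_norm _ (rshift n i)).
by rewrite !mxE (unsplitK (inr i)).
Qed.

(** A minimizer of the penalty over the compact part of [G] in the ball of radius
[r] has value at most [k * |x' - x| + e].  The two smallness hypotheses keep
it off the boundary of that ball, so it is a local minimizer on [G] itself and
must lie over [x], for want of a normal descent direction elsewhere. *)
Lemma minimizer_over_slice (G : set 'rV[R]_(n + m)) (x0 : 'rV[R]_n)
    (u0 : 'rV[R]_m) (r k e : R) (x x' : 'rV[R]_n) (u' : 'rV[R]_m) :
  0 < k -> 0 < e ->
  closed (G `&` closed_ball_ Num.norm (row_mx x0 u0) r) ->
  G (row_mx x' u') -> `|x0 - x'| < r ->
  `|x0 - x| + (k * enorm (x' - x) + e) / k < r ->
  `|u0 - u'| + (k * enorm (x' - x) + e) < r ->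
  (forall q, G q -> `|row_mx x0 u0 - q| < r -> lsubmx q != x ->
     ~ regular_normal_cone G q (penalty_descent_dir k e x u' q)) ->
  exists2 u, G (row_mx x u) & enorm (u - u') <= k * enorm (x' - x) + e.
Proof.
move=> k0 e0 Kcl Gp x'r xr u'r nodescent.
set K := G `&` _ in Kcl; set M := _ + e in xr u'r *.
have M0 : 0 <= M by rewrite addr_ge0 ?mulr_ge0 ?enorm_ge0 ?ltW.
have Kcpt : compact K.
  apply: bounded_closed_compact => //.
  exists (`|row_mx x0 u0| + r); split; first exact: num_real.
  move=> b br q [_ /= qr]; apply: le_trans (ltW br).
  rewrite -[q](subKr (row_mx x0 u0)) (le_trans (ler_normB _ _))//.
  by rewrite lerD2l.
have Kp : K (row_mx x' u').
  split=> //=; apply/ltW/sub_row_mx_norm_lt; rewrite ?row_mxKl ?row_mxKr//.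
  by apply: le_lt_trans u'r; rewrite lerDl.
have [||p] := @compact_EVT_min _ _ (penalty k e x u') K _ Kcpt.
- by exists (row_mx x' u').
- exact/continuous_subspaceT/penalty_continuous.
rewrite inE => -[Gq pr] pmin.
have pM : penalty k e x u' p <= M.
  apply: le_trans (pmin _ (mem_set Kp)) _.
  by rewrite /penalty row_mxKl row_mxKr subrr smooth_norm_at0// ltW.
have pl : k * enorm (lsubmx p - x) <= M.
  by apply: le_trans pM; rewrite lerDl sqrtr_ge0.
have prM : enorm (rsubmx p - u') <= M.
  apply: le_trans pM; apply: le_trans (enorm_le_smooth e _) _.
  by rewrite lerDr mulr_ge0 ?enorm_ge0// ltW.
have {}pr : `|row_mx x0 u0 - p| < r.
  apply: sub_row_mx_norm_lt.
    apply: le_lt_trans xr; rewrite -(subrKA x) (le_trans (ler_normD _ _))//.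
    rewrite lerD2l distrC (le_trans (norm_le_enorm _))//.
    by rewrite ler_pdivlMr// mulrC.
  apply: le_lt_trans u'r; rewrite -(subrKA u') (le_trans (ler_normD _ _))//.
  by rewrite lerD2l distrC (le_trans (norm_le_enorm _)).
have [px|px] := eqVneq (lsubmx p) x.
  by exists (rsubmx p) => //; rewrite -px hsubmxK.
exfalso; apply: (nodescent _ Gq pr px).
apply: penalty_min_normal => //; first exact: ltW.
have /nbhs_ballP : nbhs p (ball (row_mx x0 u0) r).
  by apply: open_nbhs_nbhs; split; [exact: ball_open|rewrite -ball_normE].
move=> [d d0 dr]; apply/nbhs_ballP; exists d => // q /dr.
rewrite -ball_normE => /= qr Aq.
by apply: pmin; rewrite inE; split => //=; exact: ltW.
Qed.

(** Tested against the unit vector from [lsubmx q] to [x], the first component of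
the descent direction gives exactly [k], while the second has norm at most
[1]. *)
Lemma descent_dir_not_normal (S : 'rV[R]_n -> set 'rV[R]_m) (X : set 'rV[R]_n)
    (kappa k e : R) (x : 'rV[R]_n) (u' : 'rV[R]_m) (q : 'rV[R]_(n + m)) :
  kappa < k -> 0 <= kappa -> 0 < e ->
  X x -> gph (restr S X) q -> lsubmx q != x ->
  (forall us xs, coderivative (restr S X) (lsubmx q) (rsubmx q) us xs ->
     (max_dot xs
        (closure (pos_hull [set (y - lsubmx q)%R | y in X]) `&` esphere)
      <= (kappa * enorm us)%:E)%E) ->
  ~ regular_normal_cone (gph (restr S X)) q (penalty_descent_dir k e x u' q).
Proof.
move=> kk kappa0 e0 Xx Gq qx bound; rewrite /penalty_descent_dir -enormN opprB.
set w := x - lsubmx q; set b := rsubmx q - u' => qN.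
have w0 : 0 < enorm w by rewrite enorm_gt0// subr_eq0 eq_sym.
have N0 : 0 < smooth_norm e b by exact: lt_le_trans (smooth_norm_ge _ (ltW e0)).
set xs := _ *: w in qN; set us := _ *: b in qN.
have /bound : coderivative (restr S X) (lsubmx q) (rsubmx q) us xs.
  rewrite /coderivative /= hsubmxK.
  (* A regular normal is a limiting normal through constant sequences. *)
  exists (fun=> q), (fun=> row_mx xs (- us)).
  by split=> //; exact: cvg_cst.
apply/negP; rewrite -ltNge.
have us1 : enorm us <= 1.
  rewrite enormZ; last by rewrite invr_ge0 ltW.
  rewrite ler_pdivrMl// mulr1; exact: enorm_le_smooth.
apply: (@lt_le_trans _ _ k%:E).
  by rewrite lte_fin; apply: le_lt_trans kk; rewrite ler_piMr.
apply: ereal_sup_ubound; exists ((enorm w)^-1 *: w); last first.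
  congr EFin; rewrite /xs dotvZl dotvZr -sqr_enorm expr2.
  by rewrite mulKf ?gt_eqF// divfK ?gt_eqF.
split; last by rewrite /esphere /= enormZ ?invr_ge0 ?ltW// mulVf ?gt_eqF.
apply: subset_closure; right; exists (enorm w)^-1, w; split=> //.
  by rewrite invr_gt0.
by exists x.
Qed.

End Descent.

Theorem theorem2p2 (R : realType) (n m : nat)
    (S : 'rV[R]_n -> set 'rV[R]_m) (X : set 'rV[R]_n)
    (xbar : 'rV[R]_n) (ubar : 'rV[R]_m) (kappa kappa' : R)
    (hx : X xbar) (hu : S xbar ubar)
    (hkappa : 0 < kappa) (hkappa' : kappa < kappa')
    (hS : locally_closed (gph S) (row_mx xbar ubar))
    (hX : closed X)
    (hcond : \forall x \near xbar & u \near ubar,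
       gph (restr S X) (row_mx x u) ->
       forall (us : 'rV[R]_m) (xs : 'rV[R]_n),
         coderivative (restr S X) x u us xs ->
         (max_dot xs
            (closure (pos_hull [set (y - x)%R | y in X]) `&` esphere)
          <= (kappa * enorm us)%:E)%E) :
  lipschitz_like S X xbar ubar kappa'.
Proof.
split=> //; first by rewrite ltW// (lt_trans hkappa).
have [U [/nbhs_ballP[rU /= rU0 UB] Ucl SUcl]] := hS.
case: hcond => -[P Q] /= [/nbhs_ballP[rP /= rP0 PB] /nbhs_ballP[rQ /= rQ0 QB]] PQ.
pose r := Num.min rU (Num.min rP rQ) / 2.
have rmin : 0 < Num.min rU (Num.min rP rQ) by rewrite !lt_min rU0 rP0.
have r0 : 0 < r by rewrite divr_gt0.
have : r < Num.min rU (Num.min rP rQ) by rewrite /r; lra.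
rewrite !lt_min => /and3P[rrU rrP rrQ].
pose G := gph (restr S X).
have Gcl : closed (G `&` closed_ball_ Num.norm (row_mx xbar ubar) r).
  rewrite (_ : _ `&` _ = (gph S `&` U) `&` (lsubmx @^-1` X) `&`
      closed_ball_ Num.norm (row_mx xbar ubar) r).
    apply: closedI; last exact: closed_closed_ball_.
    apply: closedI => //; apply: closed_comp => // q _.
    exact: continuous_lsubmx.
  apply/seteqP; split => q /=; last by move=> [[[Sq _] Xq] qr].
  move=> [[Xq Sq] qr]; split=> //; split=> //; split=> //.
  by apply: UB; rewrite -ball_normE /=; exact: le_lt_trans rrU.
pose k := (kappa + kappa') / 2.
have kk : kappa < k by rewrite /k; lra.
have kk' : k < kappa' by rewrite /k; lra.
have k0 : 0 < k by exact: lt_trans kk.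
(* For [x, x'] within [d] of [xbar] in the maximum norm, [kappa' * |x' - x|] is
   at most [L * d]; the radius [d] then leaves the minimizer inside the ball of
   radius [r] in both components. *)
pose L := kappa' * (Num.sqrt n%:R * 2).
have L0 : 0 <= L by rewrite !mulr_ge0 ?sqrtr_ge0// ltW// (lt_trans k0).
have Lk : 0 <= L / k by rewrite divr_ge0// ltW.
pose d := r / (2 * (1 + L + L / k)).
have D0 : 0 < 2 * (1 + L + L / k) by rewrite mulr_gt0//; lra.
have d0 : 0 < d by rewrite divr_gt0.
have dE : d * (2 * (1 + L + L / k)) = r by rewrite divfK ?gt_eqF.
have dL := mulr_ge0 (ltW d0) L0; have dLk := mulr_ge0 (ltW d0) Lk.
exists (ball xbar d), (ball ubar d); split; [exact: nbhsx_ballx..|].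
rewrite -!ball_normE => x x' [Xx xd] [Xx' x'd] u' [Su' u'd] /=.
rewrite /= in xd x'd u'd.
have [xx'|xx'] := eqVneq x' x.
  exists u'; first by rewrite -xx'.
  exists 0; first by rewrite /eball /= enorm0.
  by rewrite scaler0 addr0.
have E0 : 0 < enorm (x' - x) by rewrite enorm_gt0// subr_eq0.
pose e := (kappa' - k) * enorm (x' - x).
have e0 : 0 < e by rewrite mulr_gt0// subr_gt0.
have ME : k * enorm (x' - x) + e = kappa' * enorm (x' - x).
  by rewrite /e -mulrDl addrC subrK.
have k'0 : 0 < kappa' by exact: lt_trans kk'.
have Md : kappa' * enorm (x' - x) <= L * d.
  rewrite /L -!mulrA ler_pM2l// (le_trans (enorm_le_norm _))// ler_wpM2l//.
  rewrite -(subrKA xbar) (le_trans (ler_normD _ _))// distrC.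
  by rewrite mulr2n mulrDl mul1r lerD// ltW.
have [] := @minimizer_over_slice _ _ _ G xbar ubar r k e x x' u' k0 e0 Gcl.
- by rewrite /G /gph /restr /= row_mxKl row_mxKr.
- by lra.
- rewrite ME; have : kappa' * enorm (x' - x) / k <= L * d / k.
    by rewrite ler_pM2r// invr_gt0.
  by rewrite mulrAC; lra.
- by rewrite ME; lra.
- move=> q Gq qr qx qN.
  have Pq : P (lsubmx q).
    apply: PB; rewrite -ball_normE /=.
    exact: le_lt_trans (norm_lsubmx_sub _ ubar _) (lt_trans qr rrP).
  have Qq : Q (rsubmx q).
    apply: QB; rewrite -ball_normE /=.
    exact: le_lt_trans (norm_rsubmx_sub xbar _ _) (lt_trans qr rrQ).
  have := PQ (lsubmx q, rsubmx q) (conj Pq Qq); rewrite /= hsubmxK => /(_ Gq).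
  move=> bnd; exact: (descent_dir_not_normal kk (ltW hkappa) e0 Xx Gq qx bnd qN).
move=> u; rewrite /G /gph /restr /= row_mxKl row_mxKr ME => -[_ Su] uu'.
exists u => //; exists ((kappa' * enorm (x' - x))^-1 *: (u' - u)); last first.
  by rewrite scalerA divff ?gt_eqF ?mulr_gt0// scale1r subrKC.
rewrite /eball /= enormZ; last by rewrite invr_ge0 ltW// mulr_gt0.
by rewrite ler_pdivrMl ?mulr_gt0// mulr1 -enormN opprB.
Qed.
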